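(* For all integers $d$ and $k$ with $1 \leq k \leq d-2$, there exists an integral convex polytope $\mathcal{P}$ of dimension $d$ such that the coefficient of $n^k$ in its Ehrhart polynomial $i(\mathcal{P},n)$ is negative and all the other coefficients of $i(\mathcal{P},n)$ (of $n^0, n^1, \ldots, n^d$ other than $n^k$) are positive.
   Context: A convex polytope $\mathcal{P} \subset \mathbb{R}^N$ is integral if all its vertices have integer coordinates. For an integral convex polytope $\mathcal{P}$ of dimension $d$, the Ehrhart polynomial $i(\mathcal{P},n)$ is the polynomial in $n$ (of degree $d$ with constant term $1$) satisfying $i(\mathcal{P},n) = \#(n\mathcal{P} \cap \mathbb{Z}^N)$ for all positive integers $n$, where $n\mathcal{P} = \{n\alpha : \alpha \in \mathcal{P}\}$. *)

(* Defs.v *)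
From HB Require Import structures.
From mathcomp Require Import all_boot all_order all_algebra.
From mathcomp Require Import boolp classical_sets functions cardinality reals.

Set Implicit Arguments.
Unset Strict Implicit.
Unset Printing Implicit Defensive.

Import Order.TTheory GRing.Theory Num.Theory.

Local Open Scope classical_set_scope.
Local Open Scope card_scope.
Local Open Scope ring_scope.

Section Polytopes.
Variables (R : realType) (N : nat).
Implicit Types (P : set 'rV[R]_N) (p : {poly R}).

Definition conv_hull (m : nat) (v : 'I_m -> 'rV[R]_N) : set 'rV[R]_N :=
  [set x | exists w : 'I_m -> R,
    [/\ forall i, 0 <= w i, \sum_i w i = 1 & x = \sum_i w i *: v i]].

Definition convex_polytope P :=
  exists (m : nat) (v : 'I_m -> 'rV[R]_N), P = conv_hull v.

(* Vertices are taken as extreme points. *)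
Definition vertices P : set 'rV[R]_N :=
  [set v | P v /\ forall (x y : 'rV[R]_N) (t : R), P x -> P y -> 0 < t < 1 ->
    v = t *: x + (1 - t) *: y -> x = v /\ y = v].

Definition integer_points : set 'rV[R]_N :=
  [set x | forall j, x ord0 j \is a Num.int].

Definition integral_polytope P :=
  convex_polytope P /\ vertices P `<=` integer_points.

Definition affine_hull P : set 'rV[R]_N :=
  [set x | exists (m : nat) (v : 'I_m -> 'rV[R]_N) (a : 'I_m -> R),
    [/\ forall i, P (v i), \sum_i a i = 1 & x = \sum_i a i *: v i]].

(* The affine hull of P is a translate of a d-dimensional linear subspace;
   in particular the empty set has no dimension. *)
Definition has_dimension (d : nat) P :=
  exists (x0 : 'rV[R]_N) (V : {vspace 'rV[R]_N}),
    \dim V = d /\ affine_hull P = [set x0 + u | u in [set` V]].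

Definition dilate (n : nat) P : set 'rV[R]_N := [set n%:R *: x | x in P].

(* p is the Ehrhart polynomial of the d-dimensional polytope P. The values at
   positive integers determine p: see ehrhart_polynomial_unique. *)
Definition ehrhart_polynomial (d : nat) P p :=
  [/\ size p = d.+1, p`_0 = 1 &
      forall n : nat, (0 < n)%N ->
        exists2 m : nat, dilate n P `&` integer_points #= `I_m
                       & p.[n%:R] = m%:R].

Lemma ehrhart_polynomial_unique (d e : nat) P p q :
  ehrhart_polynomial d P p -> ehrhart_polynomial e P q -> p = q.
Proof.
move=> [_ _ hp] [_ _ hq]; apply/eqP; rewrite -subr_eq0; apply/negPn/negP => nz.
pose s : seq R := [seq n.+1%:R | n <- iota 0 (size (p - q))].
have us : uniq s.
  by rewrite map_inj_uniq ?iota_uniq // => i j /eqP; rewrite eqr_nat => /eqP[].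
have rs : all (root (p - q)) s.
  apply/allP => _ /mapP[n _ ->]; rewrite rootE !hornerE.
  have [m hm ->] := hp n.+1 isT; have [m' hm' ->] := hq n.+1 isT.
  suff -> : m = m' by rewrite subrr.
  by apply/card_eq_II; exact: card_eq_trans (card_esym hm) hm'.
have := max_poly_roots nz rs us.
by rewrite size_map size_iota ltnn.
Qed.

End Polytopes.

(* Main.v *)
Require Import Defs.
From mathcomp Require Import all_boot all_order all_algebra.
From mathcomp Require Import boolp classical_sets cardinality reals.
From mathcomp Require Import zify ring lra.

(** The Reeve tetrahedron with vertices 0, e1, e2 and e1 + e2 + 13 e3 has Ehrhart
    polynomial 13/6 n^3 + n^2 - 1/6 n + 1, which settles d = 3, k = 1. Ehrhart
    polynomials multiply under products, and dilating P by b multiplies the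
    coefficient of n^j by b^j. If only the coefficient of n^k is negative for P,
    then for L large only that of n^(k+1) is negative for P x [0, L], and for b
    large only that of n^k is negative for bP x [0, 1]; iterating the two steps
    reaches every pair (d, k). *)

Set Implicit Arguments.
Unset Strict Implicit.
Unset Printing Implicit Defensive.

Import Order.TTheory GRing.Theory Num.Theory.

Local Open Scope classical_set_scope.
Local Open Scope card_scope.
Local Open Scope ring_scope.

(** * Finite cardinalities as injective parametrizations *)

Lemma card_eq_II_param (T : Type) (A : set T) (m : nat) :
  A #= `I_m -> exists2 g : 'I_m -> T, injective g & A = range g.
Proof.
move=> cA; have := card_eq_trans (card_esym card_II) (card_esym cA).
move=> /card_bijP[f [f' fK f'K]].
have inT (i : 'I_m) : i \in [set: 'I_m] by rewrite inE.
exists (fun i => sval (f (exist _ i (inT i)))) => [i j fij|].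
  by have /(can_inj fK)[] := val_inj fij.
apply/seteqP; split=> [x xA|_ [i _ <-]]; last first.
  by case: (f _) => x xA /=; apply: set_mem.
have := f'K (exist _ x (mem_set xA)); case: (f' _) => i ii fi.
by exists i => //; rewrite (bool_irrelevance (inT i) ii) fi.
Qed.

Lemma card_eq_range (T : Type) (I : finType) (g : I -> T) :
  injective g -> range g #= `I_#|I|.
Proof.
move=> gi; apply: card_eq_trans (inj_card_eq (in2W gi)) _.
apply: card_eq_trans (card_esym card_II).
rewrite card_eq_sym.
have -> : [set: I] = @enum_val I I @` [set: 'I_#|I|].
  by apply/seteqP; split=> // i _; exists (enum_rank i); rewrite ?enum_rankK.
by rewrite card_eq_sym; apply: inj_card_eq; apply: in2W; apply: enum_val_inj.
Qed.

(** * Convex hulls, extreme points and affine hulls *)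

Section Hull.
Variables (R : realType) (N : nat).

(** Frees hulls from ordinal indices, so that products can use weights on pairs. *)
Lemma conv_hull_finP (I : finType) (v : I -> 'rV[R]_N) (x : 'rV[R]_N) :
  conv_hull (fun i : 'I_#|I| => v (enum_val i)) x <->
  exists w : I -> R,
    [/\ forall i, 0 <= w i, \sum_i w i = 1 & x = \sum_i w i *: v i].
Proof.
split=> [[w [w0 w1 ->]]|[w [w0 w1 ->]]].
  exists (w \o enum_rank); split=> [i||] /=; first exact: w0.
    by rewrite -w1 [RHS](reindex _ (onW_bij _ (enum_rank_bij I))).
  rewrite (reindex _ (onW_bij _ (enum_rank_bij I))) /=.
  by under eq_bigr do rewrite enum_rankK.
exists (w \o enum_val); split=> [i||] /=; first exact: w0.
  by rewrite -w1 [RHS](reindex _ (onW_bij _ (enum_val_bij I))).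
by rewrite [LHS](reindex _ (onW_bij _ (enum_val_bij I))).
Qed.

Lemma affine_hull_fin (I : finType) (P : set 'rV[R]_N) (v : I -> 'rV[R]_N)
    (a : I -> R) :
  (forall i, P (v i)) -> \sum_i a i = 1 ->
  affine_hull P (\sum_i a i *: v i).
Proof.
move=> Pv a1; exists #|I|, (v \o enum_val), (a \o enum_val); split=> [i||] /=.
- exact: Pv.
- by rewrite -a1 [RHS](reindex _ (onW_bij _ (enum_val_bij I))).
- by rewrite [LHS](reindex _ (onW_bij _ (enum_val_bij I))).
Qed.

Lemma conv_hull_gen (m : nat) (v : 'I_m -> 'rV[R]_N) (i : 'I_m) :
  conv_hull v (v i).
Proof.
exists (fun j => (j == i)%:R); split=> [j||]; first exact: ler0n.
  by rewrite (bigD1 i) //= eqxx big1 ?addr0 // => j /negPf ->.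
rewrite (bigD1 i) //= eqxx scale1r big1 ?addr0 // => j /negPf ->.
by rewrite scale0r.
Qed.

(** If a weight $w_i$ of an extreme point $x$ satisfies $0 < w_i < 1$, then $x$ lies strictly
    between $v_i$ and the renormalised combination of the other generators, which forces $v_i =
    x$. *)
Lemma vertices_conv_hull (m : nat) (v : 'I_m -> 'rV[R]_N) :
  vertices (conv_hull v) `<=` range v.
Proof.
move=> x [[w [w0 w1 xE]] xext].
have [i wi] : exists i, 0 < w i.
  apply: contrapT => /forallNP wn.
  suff : \sum_i w i = 0 by rewrite w1 => /eqP; rewrite oner_eq0.
  by apply: big1 => i _; apply: le_anti; rewrite w0 andbT leNgt; apply/negP.
have rest1 : \sum_(j | j != i) w j = 1 - w i.
  by rewrite -w1 [in RHS](bigD1 i) //= addrC addrK.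
have rest0 : 0 <= 1 - w i by rewrite -rest1; apply: sumr_ge0.
(* If $w_i = 1$, the other weights vanish and $x = v_i$ directly; otherwise division by $1 - w_i$ is
   legitimate. *)
exists i => //; move: rest0; rewrite le_eqVlt => /predU1P[r0|rpos].
  have wj j : j != i -> w j = 0.
    move=> ji; apply/eqP; move/eqP: rest1; rewrite -r0 psumr_eq0 //.
    by move=> /allP/(_ j); rewrite mem_index_enum ji => /(_ isT).
  rewrite xE (bigD1 i) //= big1 => [|j ji]; last by rewrite wj ?scale0r.
  by move/eqP: r0; rewrite eq_sym subr_eq0 => /eqP <-; rewrite scale1r addr0.
pose y := \sum_j (if j == i then 0 else w j / (1 - w i)) *: v j.
have [|||//] := xext (v i) y (w i) (conv_hull_gen v i).
- exists (fun j => if j == i then 0 else w j / (1 - w i)); split=> [j||//].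
    by case: ifP => // _; rewrite divr_ge0 // ltW.
  rewrite (bigD1 i) //= eqxx add0r.
  rewrite (eq_bigr (fun j => w j / (1 - w i))) => [|j /negPf -> //].
  by rewrite -mulr_suml rest1 divff // gt_eqF.
- by rewrite wi /= -subr_gt0.
- rewrite xE (bigD1 i) //= /y [in RHS](bigD1 i) //= eqxx scale0r add0r.
  congr (_ + _); rewrite scaler_sumr; apply: eq_bigr => j /negPf ->.
  by rewrite scalerA mulrC divfK // gt_eqF.
Qed.

Lemma has_dimension_full (P : set 'rV[R]_N) :
  affine_hull P = setT -> has_dimension N P.
Proof.
move=> PT; exists 0, fullv; split; first by rewrite dimvf dim_matrix; exact: mul1n.
rewrite PT; apply/seteqP; split=> // x _ /=.
by exists x; rewrite ?add0r //= memvf.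
Qed.

End Hull.


(** * Products of polytopes *)

Section Product.
Variables (R : realType) (N M : nat).
Implicit Types (P : set 'rV[R]_N) (Q : set 'rV[R]_M).

Definition prod_set P Q : set 'rV[R]_(N + M) :=
  [set x | P (lsubmx x) /\ Q (rsubmx x)].

(** The weights $a_i c_j$ have marginals $a$ and $c$, so each block collapses to its own
    combination. *)
Lemma row_mx_combination (I J : finType) (a : I -> R) (c : J -> R)
    (v : I -> 'rV[R]_N) (u : J -> 'rV[R]_M) :
  \sum_i a i = 1 -> \sum_j c j = 1 ->
  row_mx (\sum_i a i *: v i) (\sum_j c j *: u j) =
  \sum_(p : I * J) (a p.1 * c p.2) *: row_mx (v p.1) (u p.2).
Proof.
move=> a1 c1.
rewrite -(pair_bigA _ (fun i j => (a i * c j) *: row_mx (v i) (u j))) /=.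
rewrite -[RHS]hsubmxK !linear_sum; congr row_mx.
  apply: eq_bigr => i _; rewrite linear_sum.
  under eq_bigr do rewrite linearZ /= row_mxKl mulrC -scalerA.
  by rewrite -scaler_suml c1 scale1r.
under [RHS]eq_bigr do rewrite linear_sum.
rewrite exchange_big; apply: eq_bigr => j _.
under eq_bigr do rewrite linearZ /= row_mxKr -scalerA.
by rewrite -scaler_suml a1 scale1r.
Qed.

Lemma sum_prod_weights (I J : finType) (a : I -> R) (c : J -> R) :
  \sum_i a i = 1 -> \sum_j c j = 1 -> \sum_(p : I * J) a p.1 * c p.2 = 1.
Proof.
move=> a1 c1; rewrite -(pair_bigA _ (fun i j => a i * c j)) /=.
by under eq_bigr do rewrite -mulr_sumr c1 mulr1.
Qed.

(** Product weights give one inclusion, the two marginals of a weight on pairs give the other. *)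
Lemma prod_set_conv_hull (m m' : nat) (v : 'I_m -> 'rV[R]_N)
    (u : 'I_m' -> 'rV[R]_M) :
  prod_set (conv_hull v) (conv_hull u) =
  conv_hull (fun i : 'I_#|{: 'I_m * 'I_m'}| =>
    row_mx (v (enum_val i).1) (u (enum_val i).2)).
Proof.
apply/seteqP; split=> x.
  move=> [[a [a0 a1 xl]] [c [c0 c1 xr]]].
  apply/(conv_hull_finP (fun p => row_mx (v p.1) (u p.2))).
  exists (fun p => a p.1 * c p.2); split=> [p||].
  - exact: mulr_ge0.
  - exact: sum_prod_weights.
  - by rewrite -row_mx_combination // -xl -xr hsubmxK.
move=> /(conv_hull_finP (fun p => row_mx (v p.1) (u p.2)))[w [w0 w1 ->]].
split; rewrite linear_sum.
  exists (fun i => \sum_j w (i, j)); split=> [i||].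
  - exact: sumr_ge0.
  - by rewrite -w1 pair_big; apply: eq_bigr => -[].
  - under [RHS]eq_bigr do rewrite scaler_suml.
    by rewrite pair_big; apply: eq_bigr => -[i j] _; rewrite linearZ /= row_mxKl.
exists (fun j => \sum_i w (i, j)); split=> [j||].
- exact: sumr_ge0.
- by rewrite -w1 exchange_big pair_big; apply: eq_bigr => -[].
- under [RHS]eq_bigr do rewrite scaler_suml.
  rewrite exchange_big pair_big; apply: eq_bigr => -[i j] _.
  by rewrite linearZ /= row_mxKr.
Qed.

Lemma affine_hull_prod_set P Q :
  affine_hull P = setT -> affine_hull Q = setT ->
  affine_hull (prod_set P Q) = setT.
Proof.
move=> PT QT; apply/seteqP; split=> // x _.
have : affine_hull P (lsubmx x) by rewrite PT.
move=> [m [v [a [Pv a1 xl]]]].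
have : affine_hull Q (rsubmx x) by rewrite QT.
move=> [m' [u [c [Qu c1 xr]]]].
rewrite -[x]hsubmxK xl xr row_mx_combination //.
apply: (@affine_hull_fin _ _ _ _ (fun p => row_mx (v p.1) (u p.2))
  (fun p => a p.1 * c p.2)); last exact: sum_prod_weights.
by move=> p; split; rewrite ?row_mxKl ?row_mxKr.
Qed.

Lemma dilate_prod_set (n : nat) P Q :
  dilate n (prod_set P Q) = prod_set (dilate n P) (dilate n Q).
Proof.
apply/seteqP; split=> [_ [x [Px Qx] <-]|x [[y Py yE] [z Qz zE]]].
  by split; rewrite linearZ /=; [exists (lsubmx x)|exists (rsubmx x)].
exists (row_mx y z); first by split; rewrite ?row_mxKl ?row_mxKr.
by rewrite scale_row_mx yE zE hsubmxK.
Qed.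

Lemma integer_points_row_mx (x : 'rV[R]_N) (y : 'rV[R]_M) :
  integer_points (row_mx x y) <-> integer_points x /\ integer_points y.
Proof.
split=> [xy|[ix iy] j].
  by split=> j; [have := xy (lshift M j) | have := xy (rshift N j)];
    rewrite ?row_mxEl ?row_mxEr.
by rewrite mxE; case: splitP => k _.
Qed.

(** The lattice points of $n(P \times Q)$ are the pairs of lattice points of $nP$ and $nQ$, so the
    counts multiply for every $n$. *)
Lemma ehrhart_polynomial_prod_set (d e : nat) P Q (p q : {poly R}) :
  ehrhart_polynomial d P p -> ehrhart_polynomial e Q q ->
  ehrhart_polynomial (d + e) (prod_set P Q) (p * q).
Proof.
move=> [sp p0 pE] [sq q0 qE]; split=> [||n n0].
- by rewrite size_mul -?size_poly_eq0 ?sp ?sq // addSn addnS.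
- by rewrite coef0M p0 q0 mulr1.
rewrite hornerM; have [m /card_eq_II_param[g gi gE] ->] := pE n n0.
have [m' /card_eq_II_param[h hi hE] ->] := qE n n0.
exists (m * m')%N; last by rewrite natrM.
pose f (ij : 'I_m * 'I_m') := row_mx (g ij.1) (h ij.2).
have fi : injective f by move=> [i j] [i' j'] /eq_row_mx[/gi /= -> /hi /= ->].
have -> : (m * m')%N = #|{: 'I_m * 'I_m'}| by rewrite card_prod !card_ord.
rewrite dilate_prod_set (_ : _ `&` _ = range f); first exact: card_eq_range.
apply/seteqP; split=> [x [[xP xQ]]|_ [[i j] _ <-]].
  rewrite -[x]hsubmxK => /integer_points_row_mx[ixP ixQ].
  have : range g (lsubmx x) by rewrite -gE.
  have : range h (rsubmx x) by rewrite -hE.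
  by move=> [j _ <-] [i _ <-]; exists (i, j).
have [gP iP] : (dilate n P `&` integer_points (N := N)) (g i).
  by rewrite gE; exists i.
have [hQ iQ] : (dilate n Q `&` integer_points (N := M)) (h j).
  by rewrite hE; exists j.
split; first by split; rewrite ?row_mxKl ?row_mxKr.
exact/integer_points_row_mx.
Qed.

End Product.

(** * Integer dilations *)

Section Dilation.
Variables (R : realType) (N : nat).
Implicit Types (P : set 'rV[R]_N) (p : {poly R}).

Lemma dilate_dilate (n b : nat) P : dilate n (dilate b P) = dilate (n * b) P.
Proof.
apply/seteqP; split=> [_ [_ [x Px <-] <-]|_ [x Px <-]].
  by exists x => //; rewrite natrM scalerA.
by exists (b%:R *: x); [exists x | rewrite natrM scalerA].
Qed.

Lemma dilate_conv_hull (b m : nat) (v : 'I_m -> 'rV[R]_N) :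
  dilate b (conv_hull v) = conv_hull (fun i => b%:R *: v i).
Proof.
have E (w : 'I_m -> R) :
    b%:R *: (\sum_i w i *: v i) = \sum_i w i *: (b%:R *: v i).
  by rewrite scaler_sumr; apply: eq_bigr => i _; rewrite !scalerA mulrC.
apply/seteqP; split=> [_ [_ [w [w0 w1 ->]] <-]|_ [w [w0 w1 ->]]].
  by exists w; split.
by exists (\sum_i w i *: v i) => //; exists w; split.
Qed.

Lemma affine_hull_dilate (b : nat) P :
  (0 < b)%N -> affine_hull P = setT -> affine_hull (dilate b P) = setT.
Proof.
move=> b0 PT; apply/seteqP; split=> // x _.
have bn0 : b%:R != 0 :> R by rewrite pnatr_eq0 -lt0n.
have : affine_hull P (b%:R^-1 *: x) by rewrite PT.
move=> [m [v [a [Pv a1 xE]]]].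
exists m, (fun i => b%:R *: v i), a; split=> // [i|]; first by exists (v i).
rewrite -[LHS](scalerKV bn0) xE scaler_sumr.
by apply: eq_bigr => i _; rewrite !scalerA mulrC.
Qed.

(** This is $p(bX)$, given by coefficients because their signs are what matters later. *)
Definition dilate_poly (b : nat) p : {poly R} :=
  \poly_(i < size p) (b%:R ^+ i * p`_i).

Lemma coef_dilate_poly (b : nat) p (i : nat) :
  (dilate_poly b p)`_i = b%:R ^+ i * p`_i.
Proof.
by rewrite coef_poly; case: ltnP => // /(nth_default 0) ->; rewrite mulr0.
Qed.

(** Since $n(bP) = (nb)P$, the count at $n$ is $p(nb)$; $b > 0$ keeps the leading coefficient
    nonzero. *)
Lemma ehrhart_polynomial_dilate (d b : nat) P p : (0 < b)%N ->
  ehrhart_polynomial d P p -> ehrhart_polynomial d (dilate b P) (dilate_poly b p).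
Proof.
move=> b0 [sp p0 pE]; split=> [||n n0].
- rewrite size_poly_eq sp // mulf_neq0 // ?expf_neq0 ?pnatr_eq0 -?lt0n //.
  by rewrite -[d]/(d.+1.-1) -sp -/(lead_coef p) lead_coef_eq0 -size_poly_eq0 sp.
- by rewrite coef_dilate_poly expr0 mul1r.
have nb0 : (0 < n * b)%N by rewrite muln_gt0 n0.
have [m cm pm] := pE _ nb0.
exists m; first by rewrite dilate_dilate.
rewrite -pm horner_poly horner_coef; apply: eq_bigr => i _.
by rewrite natrM exprMn mulrC [_%:R ^+ i * p`_i]mulrC mulrCA mulrA.
Qed.

End Dilation.

(** * Full-dimensional lattice polytopes *)

Section LatticePolytope.
Variable R : realType.

(** An invariant stable under products and dilations: integrality is asked of some generators rather
    than of the extreme points, and dimension $d$ is expressed by spanning the ambient space. *)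
Definition full_lattice_polytope (d : nat) (P : set 'rV[R]_d) (p : {poly R}) :=
  [/\ exists (m : nat) (v : 'I_m -> 'rV[R]_d),
        (forall i, integer_points (v i)) /\ P = conv_hull v,
      affine_hull P = setT & ehrhart_polynomial d P p].

Lemma full_lattice_polytope_integral (d : nat) (P : set 'rV[R]_d) p :
  full_lattice_polytope P p -> integral_polytope P.
Proof.
move=> [[m [v [iv ->]]] _ _]; split; first by exists m, v.
by move=> x /vertices_conv_hull[i _ <-].
Qed.

Lemma full_lattice_polytope_dilate (d b : nat) (P : set 'rV[R]_d) p :
  (0 < b)%N -> full_lattice_polytope P p ->
  full_lattice_polytope (dilate b P) (dilate_poly b p).
Proof.
move=> b0 [[m [v [iv PE]]] PT Pp]; split.
- exists m, (fun i => b%:R *: v i); split; last by rewrite PE dilate_conv_hull.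
  by move=> i j; rewrite mxE rpredM ?iv ?natr_int.
- exact: affine_hull_dilate.
- exact: ehrhart_polynomial_dilate.
Qed.

Lemma full_lattice_polytope_prod (d e : nat) (P : set 'rV[R]_d)
    (Q : set 'rV[R]_e) p q :
  full_lattice_polytope P p -> full_lattice_polytope Q q ->
  full_lattice_polytope (prod_set P Q) (p * q).
Proof.
move=> [[m [v [iv PE]]] PT Pp] [[m' [u [iu QE]]] QT Qq]; split.
- exists #|{: 'I_m * 'I_m'}|.
  exists (fun i => row_mx (v (enum_val i).1) (u (enum_val i).2)).
  split; last by rewrite PE QE prod_set_conv_hull.
  by move=> i; apply/integer_points_row_mx.
- exact: affine_hull_prod_set.
- exact: ehrhart_polynomial_prod_set.
Qed.

(** The segment is $[0, L]$; the lattice points of its $n$-th dilate are $0, \dots, Ln$. *)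
Lemma full_lattice_polytope_segment (L : nat) : (0 < L)%N ->
  exists P : set 'rV[R]_1, full_lattice_polytope P (1 + L%:R *: 'X).
Proof.
move=> L0; have Ln0 : L%:R != 0 :> R by rewrite pnatr_eq0 -lt0n.
pose v (i : 'I_2) : 'rV[R]_1 := const_mx (i * L)%:R.
exists (conv_hull v); split.
- by exists 2%N, v; split=> // i j; rewrite mxE natr_int.
- apply/seteqP; split=> // x _; exists 2%N, v.
  exists (fun i => if i == 0 then 1 - x 0 0 / L%:R else x 0 0 / L%:R); split.
  + exact: conv_hull_gen.
  + by rewrite big_ord_recl big_ord1 /= subrK.
  + apply/rowP => j; rewrite (ord1 j) big_ord_recl big_ord1 /= !mxE.
    by rewrite mul0n mulr0 add0r mul1n divfK.
split=> [||n n0].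
- rewrite addrC size_polyDl size_scale ?size_polyX ?size_poly1 //.
- by rewrite coefD coefZ coefX coef1 mulr0 addr0.
exists (L * n).+1; last first.
  by rewrite !hornerE -natrM -natr1 addrC.
pose f (i : 'I_(L * n).+1) : 'rV[R]_1 := const_mx i%:R.
have fi : injective f.
  move=> i j /rowP/(_ 0); rewrite !mxE => /eqP; rewrite eqr_nat => /eqP.
  exact: val_inj.
rewrite (_ : _ `&` _ = range f).
  by have := card_eq_range fi; rewrite card_ord.
rewrite dilate_conv_hull; apply/seteqP; split=> [x [[w [w0 w1 xE]] ix]|_ [i _ <-]].
  (* Only the endpoint $L$ contributes, so the coordinate lies in $[0, Ln]$; being an integer, it is
     one of the listed values. *)
  have x0E : x 0 0 = w 1 * (L * n)%:R.
    rewrite xE big_ord_recl big_ord1 /= !mxE mul0n !mulr0 add0r mul1n mulnC natrM.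
    by congr (w _ * _); apply: val_inj.
  have w11 : w 1 <= 1.
    move: w1; rewrite big_ord_recl big_ord1 /= (_ : lift _ _ = 1); last exact: val_inj.
    by have := w0 0; lra.
  have : x 0 0 \is a Num.nat.
    by rewrite natrEint ix x0E mulr_ge0.
  move=> /natrP[z xz].
  have zL : (z < (L * n).+1)%N.
    by rewrite ltnS -(ler_nat R) -xz x0E ler_piMl.
  by exists (Ordinal zL) => //; apply/rowP => j; rewrite (ord1 j) mxE xz.
split; last by move=> j; rewrite mxE natr_int.
have Lnn0 : (L * n)%:R != 0 :> R by rewrite pnatr_eq0 muln_eq0 negb_or -!lt0n L0.
pose t : R := i%:R / (L * n)%:R.
exists (fun j => if j == 0 then 1 - t else t); split.
- move=> j; case: ifP => _; last by rewrite divr_ge0.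
  rewrite subr_ge0 ler_pdivrMr ?ltr0n ?muln_gt0 ?L0 // mul1r ler_nat.
  by rewrite -ltnS.
- by rewrite big_ord_recl big_ord1 /= subrK.
- apply/rowP => j; rewrite big_ord_recl big_ord1 /= !mxE.
  by rewrite mul0n !mulr0 add0r mul1n -natrM [(n * L)%N]mulnC divfK.
Qed.

End LatticePolytope.

(** * Propagation of the sign pattern *)

Section SignPattern.
Variable R : realType.

Definition only_negative_coef (p : {poly R}) (d k : nat) :=
  p`_k < 0 /\ forall j : nat, (j <= d)%N -> j <> k -> 0 < p`_j.

(** One factor must serve two inequalities at once: one keeps a coefficient negative, the other
    makes its upper or lower neighbour positive. *)
Lemma exists_nat_dominating (a b a' b' : R) : 0 < b -> 0 < b' ->
  exists n : nat, [/\ (0 < n)%N, a < n%:R * b & a' < n%:R * b'].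
Proof.
move=> b0 b0'; pose m := maxn (Num.bound `|a / b|) (Num.bound `|a' / b'|).
exists m.+1; split=> //; rewrite -ltr_pdivrMr //.
  apply: le_lt_trans (ler_norm _) (lt_le_trans (archi_boundP (normr_ge0 _)) _).
  by rewrite ler_nat; apply/leqW/leq_maxl.
apply: le_lt_trans (ler_norm _) (lt_le_trans (archi_boundP (normr_ge0 _)) _).
by rewrite ler_nat; apply/leqW/leq_maxr.
Qed.

Lemma coef_mul_segment (p : {poly R}) (L j : nat) :
  (p * (1 + L%:R *: 'X))`_j = p`_j + (if j is i.+1 then L%:R * p`_i else 0).
Proof.
rewrite mulrDr mulr1 coefD -scalerAr coefZ coefMX; case: j => [|i] //=.
by rewrite mulr0.
Qed.

(** The new coefficients are $p_j + L p_{j-1}$. For $L$ large, $p_{k+1} + L p_k$ is negative, while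
    $p_k + L p_{k-1}$ is positive because $k \geq 1$ gives $p_{k-1} > 0$. *)
Lemma only_negative_coef_mul_long (p : {poly R}) (d k : nat) :
  size p = d.+1 -> (0 < k < d)%N -> only_negative_coef p d k ->
  exists2 L : nat, (0 < L)%N &
    only_negative_coef (p * (1 + L%:R *: 'X)) d.+1 k.+1.
Proof.
move=> sp /andP[k0 kd] [pk pj].
have pk1 : 0 < p`_k.-1 by apply: pj; lia.
have npk : 0 < - p`_k by rewrite oppr_gt0.
have [L [L0 h1 h2]] := exists_nat_dominating (p`_k.+1) (- p`_k) npk pk1.
exists L => //; have LR : 0 < L%:R :> R by rewrite ltr0n.
split=> [|[|i] jd jk]; rewrite coef_mul_segment.
- by move: h1; rewrite mulrN; lra.
- by rewrite addr0; apply: pj; lia.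
have pi : 0 < p`_i by apply: pj; lia.
have Lpi : 0 < L%:R * p`_i by rewrite mulr_gt0.
have [iE|ik] := eqVneq i.+1 k.
  by move: h2; rewrite -iE /=; lra.
(* For the new top coefficient, $p_{d+1}$ is the default value $0$, which leaves $L p_d > 0$. *)
have [id|id] := eqVneq i d.
  by rewrite id nth_default ?sp // add0r -id.
by rewrite addr_gt0 // pj //; [lia | apply/eqP].
Qed.

(** The coefficient of degree $i + 1$ is $b^i (b p_{i+1} + p_i)$. For $b$ large it is negative at $i
    = k - 1$, and positive at $i = k$ because $k < d$ gives $p_{k+1} > 0$. *)
Lemma only_negative_coef_dilate_mul (p : {poly R}) (d k : nat) :
  size p = d.+1 -> (0 < k < d)%N -> only_negative_coef p d k ->
  exists2 b : nat, (0 < b)%N &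
    only_negative_coef (dilate_poly b p * (1 + 1%:R *: 'X)) d.+1 k.
Proof.
move=> sp /andP[k0 kd] [pk pj].
have pk1 : 0 < p`_k.+1 by apply: pj; lia.
have npk : 0 < - p`_k by rewrite oppr_gt0.
have [b [b0 h1 h2]] := exists_nat_dominating (p`_k.-1) (- p`_k) npk pk1.
exists b => //; have bR i : 0 < b%:R ^+ i :> R by rewrite exprn_gt0 ?ltr0n.
have E i : (dilate_poly b p * (1 + 1%:R *: 'X))`_i.+1 =
    b%:R ^+ i * (b%:R * p`_i.+1 + p`_i).
  by rewrite coef_mul_segment !coef_dilate_poly exprSr; ring.
split=> [|[|i] jd jk].
- by rewrite -(prednK k0) E prednK // pmulr_rlt0 //; move: h1; rewrite mulrN; lra.
- by rewrite coef_mul_segment addr0 coef_dilate_poly mulr_gt0 // pj //; lia.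
rewrite E pmulr_rgt0 //.
have [->|ik] := eqVneq i k; first by lra.
have pi : 0 < p`_i by apply: pj; [lia | apply/eqP].
have [id|id] := eqVneq i d.
  by rewrite {1}id nth_default ?sp // mulr0 add0r.
by rewrite addr_gt0 // mulr_gt0 ?ltr0n // pj //; lia.
Qed.

End SignPattern.

(** * The Reeve tetrahedron *)

Section Reeve.
Variable R : realType.

(** Stars and bars. Each entry is at most $n$, so triples over ['I_n.+1] lose nothing and make the
    type finite. *)
Lemma nat_simplex_param (n : nat) :
  exists (I : finType) (h : I -> nat * nat * nat),
    [/\ injective h, #|I| = 'C(n.+3, 3) &
        forall a b c, (exists i, h i = (a, b, c)) <-> (a + b + c <= n)%N].
Proof.
pose A := [set t : 3.-tuple 'I_n.+1 | (\sum_(i <- t) i <= n)%N]%SET.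
exists {t | t \in A}.
pose h3 (t : 3.-tuple 'I_n.+1) : nat * nat * nat :=
  (tnth t 0 : nat, tnth t 1 : nat, tnth t 2%:R : nat).
have sumE (t : 3.-tuple 'I_n.+1) :
    (\sum_(i <- t) i = (h3 t).1.1 + (h3 t).1.2 + (h3 t).2)%N.
  rewrite big_tuple !big_ord_recl big_ord0 addn0 addnA /h3 /=.
  by congr (_ + tnth t _ + tnth t _)%N; apply: val_inj.
exists (h3 \o val); split.
- move=> t t' /= [h0 h1 h2]; apply: val_inj; apply: eq_from_tnth => i.
  apply: val_inj; case: i => [[|[|[|//]]] ltn] /=.
  + by rewrite (_ : Ordinal _ = 0) //; apply: val_inj.
  + by rewrite (_ : Ordinal _ = 1) //; apply: val_inj.
  + by rewrite (_ : Ordinal _ = 2%:R) //; apply: val_inj.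
- by rewrite card_sig -[n.+3]/(3 + n)%N -card_partial_ord_partitions.
move=> a b c; split=> [[[t tA] /= tE]|abc].
  by move: tA; rewrite inE sumE tE.
have ha : (a < n.+1)%N by lia.
have hb : (b < n.+1)%N by lia.
have hc : (c < n.+1)%N by lia.
pose t := [tuple Ordinal ha; Ordinal hb; Ordinal hc].
have tA : t \in A by rewrite inE sumE.
by exists (exist _ t tA).
Qed.

(** This is the previous simplex for $n - 2$; for $n < 2$ it is empty and the binomial vanishes. *)
Lemma nat_simplex_shift_param (n : nat) :
  exists (I : finType) (h : I -> nat * nat * nat),
    [/\ injective h, #|I| = 'C(n.+1, 3) &
        forall a b c, (exists i, h i = (a, b, c)) <-> (a + b + c + 2 <= n)%N].
Proof.
case: n => [|[|n]]; last first.
- have [I [h [hi cI hP]]] := nat_simplex_param n.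
  exists I, h; split=> // a b c.
  by rewrite hP; lia.
- exists void, (fun=> (0, 0, 0)%N); split=> [[]||a b c].
    by rewrite card_void.
  by split=> [[[]]|]; lia.
- exists void, (fun=> (0, 0, 0)%N); split=> [[]||a b c].
    by rewrite card_void.
  by split=> [[[]]|]; lia.
Qed.

Definition row3 (x y z : R) : 'rV[R]_3 := \row_j [:: x; y; z]`_j.

Lemma row3_inj (x y z x' y' z' : R) :
  row3 x y z = row3 x' y' z' -> [/\ x = x', y = y' & z = z'].
Proof.
move=> /rowP e; have := (e 0, e 1, e 2%:R).
by rewrite !mxE /= => -[[-> ->] ->].
Qed.

Lemma row3_surj (u : 'rV[R]_3) : u = row3 (u 0 0) (u 0 1) (u 0 2%:R).
Proof.
by apply/rowP => -[[|[|[|//]]] ltj]; rewrite !mxE /=; congr (u _ _); apply: val_inj.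
Qed.

(** With height $r$ in place of $13$, the linear Ehrhart coefficient would be $(12 - r)/6$, so $13$
    is the least height that makes it negative. *)
Definition reeve_vertex (i : 'I_4) : 'rV[R]_3 :=
  nth 0 [:: row3 0 0 0; row3 1 0 0; row3 0 1 0; row3 1 1 13%:R] i.

(** The weights may have any sign, and the scale $n$ is free: this serves both the dilates and, with
    $n = 1$, the affine hull. *)
Lemma reeve_combination (w : 'I_4 -> R) (n : R) :
  \sum_i w i *: (n *: reeve_vertex i) =
  row3 (n * (w 1 + w 3%:R)) (n * (w 2%:R + w 3%:R)) (n * (w 3%:R * 13%:R)).
Proof.
rewrite !big_ord_recl big_ord0 /reeve_vertex /=.
rewrite (_ : lift _ _ = 1); last exact: val_inj.
rewrite (_ : lift _ _ = 2%:R); last exact: val_inj.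
rewrite (_ : lift _ _ = 3%:R); last exact: val_inj.
by apply/rowP => -[[|[|[|//]]] ltj]; rewrite !mxE /=; ring.
Qed.

Definition weights4 (a b c e : R) (i : 'I_4) : R := [:: a; b; c; e]`_i.

Lemma sum_weights4 (w : 'I_4 -> R) :
  \sum_i w i = w 0 + w 1 + w 2%:R + w 3%:R.
Proof.
rewrite !big_ord_recl big_ord0 addr0 !addrA.
by congr (w _ + w _ + w _ + w _); apply: val_inj.
Qed.

(** The four facet inequalities say that the barycentric coordinates $z/13$, $x - z/13$, $y - z/13$
    and $n - x - y + z/13$, which sum to $n$, are nonnegative. *)
Lemma dilate_reeveP (n : nat) (x y z : R) : (0 < n)%N ->
  dilate n (conv_hull reeve_vertex) (row3 x y z) <->
  [/\ 0 <= z, z <= 13%:R * x, z <= 13%:R * y & 13%:R * (x + y) <= 13%:R * n%:R + z].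
Proof.
move=> n0; have nR : 0 < n%:R :> R by rewrite ltr0n.
rewrite dilate_conv_hull; split.
  move=> [w [w0 w1]]; rewrite reeve_combination => /row3_inj[-> -> ->].
  rewrite sum_weights4 in w1.
  have := (w0 0, w0 1, w0 2%:R, w0 3%:R) => -[[[h0 h1] h2] h3].
  (* With the products $n w_i$ as atoms, the goals become linear. *)
  have {}w1 : n%:R = n%:R * w 0 + n%:R * w 1 + n%:R * w 2%:R + n%:R * w 3%:R.
    by rewrite -!mulrDr w1 mulr1.
  have := (mulr_ge0 (ltW nR) h0, mulr_ge0 (ltW nR) h1,
           mulr_ge0 (ltW nR) h2, mulr_ge0 (ltW nR) h3) => -[[[k0 k1] k2] k3].
  by split; lra.
move=> [h0 h1 h2 h3].
exists (weights4 ((n%:R - x - y + z / 13%:R) / n%:R) ((x - z / 13%:R) / n%:R)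
                 ((y - z / 13%:R) / n%:R) (z / 13%:R / n%:R)).
split.
- move=> -[[|[|[|[|//]]]] lti]; apply: divr_ge0 (ltW nR) => /=; lra.
- by rewrite sum_weights4 /weights4 /=; field; rewrite gt_eqF.
- by rewrite reeve_combination /weights4 /=; congr row3; field; rewrite gt_eqF.
Qed.

Definition reeve_poly : {poly R} := Poly [:: 1; - (6%:R^-1); 1; 13%:R / 6%:R].

Lemma only_negative_coef_reeve_poly : only_negative_coef reeve_poly 3 1.
Proof.
split; first by rewrite coef_Poly /= oppr_lt0 invr_gt0 ltr0n.
by case=> [|[|[|[|//]]]] // _ _; rewrite coef_Poly /= ?ltr01 // divr_gt0 ?ltr0n.
Qed.

(** Six times either side is $(n+3)(n+2)(n+1) + 12(n+1)n(n-1) = 13n^3 + 6n^2 - n + 6$. *)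
Lemma reeve_poly_nat (n : nat) :
  reeve_poly.[n%:R] = ('C(n.+3, 3) + 12 * 'C(n.+1, 3))%:R.
Proof.
have bin3 (m : nat) : ('C(m.+2, 3) * 6 = m.+2 * m.+1 * m)%N.
  by rewrite (bin_ffact m.+2 3) !ffactnS ffactn0 muln1 mulnA.
have e1 := congr1 (fun m : nat => m%:R : R) (bin3 n.+1).
rewrite horner_Poly /= natrD natrM; case: n e1 => [|n] e1.
  by rewrite binn bin_small // mulr0; field.
have e2 := congr1 (fun m : nat => m%:R : R) (bin3 n).
move: e1 e2; move: 'C(n.+4, 3) 'C(n.+2, 3) => c c'.
by rewrite -(addn4 n) -(addn3 n) -(addn2 n) -(addn1 n) !natrM !natrD; lra.
Qed.

(** Lattice points are sorted by $z$ modulo $13$. For $z = 13c$, writing $x = c + a$ and $y = c + b$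
    turns the inequalities into $a + b + c \leq n$. For $z = 13c + r$ with $0 < r < 13$, both $x$
    and $y$ exceed $c$; writing $x = c + a + 1$ and $y = c + b + 1$ gives $a + b + c + 2 \leq n$ for
    each of the $12$ residues. *)
Lemma ehrhart_reeve : ehrhart_polynomial 3 (conv_hull reeve_vertex) reeve_poly.
Proof.
split=> [||n n0].
- by rewrite /reeve_poly (PolyK (c := 0)) //= mulf_neq0 ?invr_eq0 ?pnatr_eq0.
- by rewrite coef_Poly.
exists ('C(n.+3, 3) + 12 * 'C(n.+1, 3))%N; last exact: reeve_poly_nat.
have [I [h [hi cI hP]]] := nat_simplex_param n.
have [J [l [li cJ lP]]] := nat_simplex_shift_param n.
(* The third coordinate is 13 c + r with 0 <= r < 13; r = 0 is the left summand
   and r > 0 forces a shift of the simplex by 2. *)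
pose f (s : I + 'I_12 * J) : 'rV[R]_3 :=
  match s with
  | inl i => let: (a, b, c) := h i in row3 (c + a)%:R (c + b)%:R (13 * c)%:R
  | inr (r, j) => let: (a, b, c) := l j in
      row3 (c + a).+1%:R (c + b).+1%:R (13 * c + r.+1)%:R
  end.
have natR_inj (i j : nat) : i%:R = j%:R :> R -> i = j.
  by move=> /eqP; rewrite eqr_nat => /eqP.
(* The residue of the third coordinate separates the summands and recovers [r]; the quotient gives
   [c], and then [a] and [b] follow. *)
have fi : injective f.
  move=> [i|[r j]] [i'|[r' j']] /=.
  - case hE: (h i) => [[a b] c]; case hE': (h i') => [[a' b'] c'].
    move=> /row3_inj[/natR_inj e1 /natR_inj e2 /natR_inj e3].
    congr inl; apply: hi; rewrite hE hE'; congr (_, _, _); lia.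
  - case: (h i) => [[a b] c]; case: (l j') => [[a' b'] c'].
    move=> /row3_inj[_ _ /natR_inj e3]; have := ltn_ord r'; lia.
  - case: (h i') => [[a b] c]; case: (l j) => [[a' b'] c'].
    move=> /row3_inj[_ _ /natR_inj e3]; have := ltn_ord r; lia.
  - case lE: (l j) => [[a b] c]; case lE': (l j') => [[a' b'] c'].
    move=> /row3_inj[/natR_inj e1 /natR_inj e2 /natR_inj e3].
    have := ltn_ord r; have := ltn_ord r' => r12 r12'.
    have er : r = r' by apply: val_inj => /=; lia.
    subst r'; congr (inr (_, _)); apply: li; rewrite lE lE'; congr (_, _, _); lia.
have -> : ('C(n.+3, 3) + 12 * 'C(n.+1, 3))%N = #|{: I + 'I_12 * J}|.
  by rewrite card_sum card_prod card_ord cI cJ.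
rewrite (_ : _ `&` _ = range f); first exact: card_eq_range.
have natP (x y z : nat) :
  dilate n (conv_hull reeve_vertex) (row3 x%:R y%:R z%:R) <->
  [/\ (z <= 13 * x)%N, (z <= 13 * y)%N & (13 * (x + y) <= 13 * n + z)%N].
  rewrite dilate_reeveP // -natrD -!natrM -natrD !ler_nat.
  by split=> [[]|[]].
have intP (x y z : nat) : integer_points (row3 x%:R y%:R z%:R).
  by move=> [[|[|[|//]]] ltj]; rewrite mxE natr_int.
apply/seteqP; split=> [u [uP iu]|_ [s _ <-]].
  (* The inequalities $0 \leq z \leq 13x$ and $z \leq 13y$ make the integer coordinates
     nonnegative. *)
  have : [/\ u 0 0 \is a Num.nat, u 0 1 \is a Num.nat & u 0 2%:R \is a Num.nat].
    move: uP; rewrite {1}[u]row3_surj => /dilate_reeveP-/(_ n0)[h0 h1 h2 _].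
    by rewrite !natrEint !iu /=; split; lra.
  move=> [/natrP[x xE] /natrP[y yE] /natrP[z zE]].
  move: uP; rewrite [u]row3_surj xE yE zE => /natP[h1 h2 h3].
  have := divn_eq z 13; have := ltn_pmod z (isT : (0 < 13)%N).
  move: (z %/ 13)%N (z %% 13)%N => c [_ zc|r r13 zc].
    have [|i hE] := (hP (x - c) (y - c) c)%N.2; first by lia.
    by exists (inl i) => //=; rewrite hE; congr (row3 _%:R _%:R _%:R); lia.
  (* A positive remainder forces $x, y \geq c + 1$, so the truncated subtractions are exact. *)
  have [|j lE] := (lP (x - c.+1) (y - c.+1) c)%N.2; first by lia.
  have r12 : (r < 12)%N by lia.
  exists (inr (Ordinal r12, j)) => //=; rewrite lE.
  by congr (row3 _%:R _%:R _%:R); lia.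
case: s => [i|[r j]] /=.
  case hE: (h i) => [[a b] c]; split=> //; apply/natP.
  have /hP abc : exists i, h i = (a, b, c) by exists i.
  by split; lia.
case lE: (l j) => [[a b] c]; split=> //; apply/natP.
have /lP abc : exists j, l j = (a, b, c) by exists j.
by have r12 := ltn_ord r; split; lia.
Qed.

Lemma full_lattice_polytope_reeve :
  full_lattice_polytope (conv_hull reeve_vertex) reeve_poly.
Proof.
split; last exact: ehrhart_reeve.
- exists 4%N, reeve_vertex; split=> //.
  move=> [[|[|[|[|//]]]] lti] [[|[|[|//]]] ltj];
  by rewrite mxE /= ?natr_int ?rpred0 ?rpred1.
- apply/seteqP; split=> // u _; rewrite [u]row3_surj.
  move: (u 0 0) (u 0 1) (u 0 2%:R) => x y z.
  exists 4%N, reeve_vertex.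
  exists (weights4 (1 - x - y + z / 13%:R) (x - z / 13%:R) (y - z / 13%:R)
                   (z / 13%:R)); split.
  + exact: conv_hull_gen.
  + by rewrite sum_weights4 /weights4 /=; field.
  (* Inserts the scale $n = 1$ required by [reeve_combination]. *)
  + under eq_bigr do rewrite -[reeve_vertex _]scale1r.
    by rewrite reeve_combination /weights4 /=; congr row3; field.
Qed.

End Reeve.

(** * Induction over the pairs $(d, k)$ *)

Definition realizable (R : realType) (d k : nat) :=
  exists (P : set 'rV[R]_d) (p : {poly R}),
    full_lattice_polytope P p /\ only_negative_coef p d k.

Lemma realizable_stretch (R : realType) (d k : nat) : (0 < k < d)%N ->
  realizable R d k -> realizable R d.+1 k.+1.
Proof.
move=> kd [P [p [Pp pk]]]; have [_ _ [sp _ _]] := Pp.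
have [L L0 hL] := only_negative_coef_mul_long sp kd pk.
have [S Sp] := full_lattice_polytope_segment R L0.
(* The product lives in dimension [d + 1], which is not convertible to [d.+1]. *)
rewrite -{1}addn1; exists (prod_set P S), (p * (1 + L%:R *: 'X)).
by split; [exact: full_lattice_polytope_prod | rewrite addn1].
Qed.

Lemma realizable_dilate (R : realType) (d k : nat) : (0 < k < d)%N ->
  realizable R d k -> realizable R d.+1 k.
Proof.
move=> kd [P [p [Pp pk]]]; have [_ _ [sp _ _]] := Pp.
have [b b0 hb] := only_negative_coef_dilate_mul sp kd pk.
have [S Sp] := full_lattice_polytope_segment R (ltn0Sn 0).
rewrite -addn1; exists (prod_set (dilate b P) S), (dilate_poly b p * (1 + 1%:R *: 'X)).
split; last by rewrite addn1.
exact: full_lattice_polytope_prod (full_lattice_polytope_dilate b0 Pp) Sp.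
Qed.

(** Here $e = k - 1$ and $f = d - k - 2$ range freely over the naturals. From $(3, 1)$, dilation
    steps raise $d$ alone until $e = 0$ is settled for all $f$; stretching steps then raise $d$ and
    $k$ together. *)
Lemma realizable_shift (R : realType) (e f : nat) : realizable R (e + f + 3) e.+1.
Proof.
elim: e => [|e IHe]; last by apply: realizable_stretch IHe; lia.
elim: f => [|f IHf]; last by apply: realizable_dilate IHf; lia.
exists (conv_hull (@reeve_vertex R)), (reeve_poly R); split.
  exact: full_lattice_polytope_reeve.
exact: only_negative_coef_reeve_poly.
Qed.

Theorem theorem0p2 (R : realType) (d k : nat) :
  (1 <= k)%N -> (k + 2 <= d)%N ->
  exists (N : nat) (P : set 'rV[R]_N) (p : {poly R}),
    [/\ integral_polytope P, has_dimension d P, ehrhart_polynomial d P p &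
        p`_k < 0 /\ forall j : nat, (j <= d)%N -> j <> k -> 0 < p`_j].
Proof.
move=> k1 kd; have := realizable_shift R k.-1 (d - k - 2).
rewrite prednK // (_ : (_ + 3)%N = d); last by lia.
move=> [P [p [Pp pk]]]; exists d, P, p; split=> //.
- exact: full_lattice_polytope_integral Pp.
- by have [_ PT _] := Pp; apply: has_dimension_full.
- by have [_ _ ?] := Pp.
Qed.
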